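(* Let $r\ge 3$ be a fixed integer. Then, as $d\to\infty$, $$\chi_s^r(d)=\Omega\left(\left(\frac{d^3}{\ln d}\right)^{\frac{1}{3r-4}}\right)\qquad\text{and}\qquad \chi_a^r(d)=\Omega\left(\left(\frac{d^3}{\ln d}\right)^{\frac{1}{3r-4}}\right).$$
   Context: All hypergraphs are finite. A hypergraph is $r$-uniform if every hyperedge has exactly $r$ vertices; $K_n^r$ is the complete $r$-uniform hypergraph on $n$ vertices; $\Delta(H)$ is the maximum vertex degree of $H$ (the degree of a vertex is the number of hyperedges containing it). Subhypergraphs are understood as formed by a set of hyperedges together with the vertices in their union. A hyperedge is monochromatic under a vertex coloring if all its vertices have the same color; a subhypergraph is bicolored if its vertices receive exactly two colors. A star is a hypergraph formed by hyperedges $E_1,\dots,E_m$, $m\ge 2$, with $\bigcap_i E_i\ne\emptyset$. A cycle of length $m$ is a subhypergraph with (distinct) hyperedges $E_0,\dots,E_{m-1}$ such that $E_i\cap E_{i+1}\ne\emptyset$ and $E_{i-1}\cap E_i\cap E_{i+1}=\emptyset$ for each $i$, indices modulo $m$. A star coloring of a hypergraph $H$ is a vertex coloring of $H$ with no monochromatic hyperedge in which the only bicolored connected subhypergraphs with at least two hyperedges are stars. An acyclic coloring of $H$ is a vertex coloring of $H$ with no monochromatic hyperedge and no bicolored cycle of length at least three. $\chi_s(H)$ (resp. $\chi_a(H)$) is the minimum number of colors in a star (resp. acyclic) coloring of $H$, and $$\chi_s^r(d)=\max\{\chi_s(H): H\subset K_n^r\text{ for some } n,\ \Delta(H)=d\},\qquad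 \chi_a^r(d)=\max\{\chi_a(H): H\subset K_n^r\text{ for some } n,\ \Delta(H)=d\},$$ i.e. the maxima are over all $r$-uniform hypergraphs $H$ with maximum degree $d$. *)

(* Defs.v *)
From mathcomp Require Import all_boot all_order all_algebra.
From mathcomp Require Import all_classical all_reals all_analysis.

Set Implicit Arguments.
Unset Strict Implicit.
Unset Printing Implicit Defensive.

(* A hypergraph is given by its set of hyperedges, a subhypergraph by a subset
   of these; the vertex set is [finset.cover H], the union of the hyperedges. *)
Definition hypergraph (T : finType) := {set {set T}}.

Definition complete_hypergraph (n r : nat) : hypergraph 'I_n :=
  [set E : {set 'I_n} | #|E| == r]%SET.

Definition degree (T : finType) (H : hypergraph T) (v : T) : nat :=
  #|[set E in H | v \in E]%SET|.

Definition max_degree (T : finType) (H : hypergraph T) : nat :=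
  \max_(v in finset.cover H) degree H v.

(* Colorings are functions on the whole of T, but only their values on
   [finset.cover H] matter. *)
Definition monochromatic (T C : finType) (f : T -> C) (E : {set T}) : Prop :=
  {in E &, forall x y, f x = f y}.

Definition bicolored (T C : finType) (f : T -> C) (S : hypergraph T) : Prop :=
  #|(f @: finset.cover S)%SET| = 2.

Definition adjacent (T : finType) (S : hypergraph T) : rel T :=
  fun x y => [exists E in S, (x \in E) && (y \in E)].

Definition connected_hypergraph (T : finType) (S : hypergraph T) : Prop :=
  {in finset.cover S &, forall x y, connect (adjacent S) x y}.

Definition is_star (T : finType) (S : hypergraph T) : Prop :=
  1 < #|S| /\ exists v : T, {in S, forall E : {set T}, v \in E}.

(* [ordS] and [ord_pred] are successor and predecessor modulo m. *)
Definition is_cycle (T : finType) (m : nat) (S : hypergraph T) : Prop :=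
  exists E : 'I_m -> {set T},
    [/\ injective E,
        S = [set E i | i : 'I_m]%SET,
        forall i, (E i :&: E (ordS i))%SET <> finset.set0
      & forall i, (E (ord_pred i) :&: E i :&: E (ordS i))%SET = finset.set0].

Definition no_monochromatic_edge (T C : finType) (H : hypergraph T)
    (f : T -> C) : Prop :=
  {in H, forall E : {set T}, ~ monochromatic f E}.

Definition star_coloring (T C : finType) (H : hypergraph T) (f : T -> C) :
    Prop :=
  no_monochromatic_edge H f /\
  forall S : hypergraph T, S \subset H -> 1 < #|S| ->
    connected_hypergraph S -> bicolored f S -> is_star S.

Definition acyclic_coloring (T C : finType) (H : hypergraph T) (f : T -> C) :
    Prop :=
  no_monochromatic_edge H f /\
  forall (m : nat) (S : hypergraph T), 3 <= m -> S \subset H ->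
    is_cycle m S -> ~ bicolored f S.

(* Minimum and maximum of a set of naturals, 0 when it does not exist.  For
   the sets below they exist as soon as r >= 3 and d >= 1; in any case the
   default 0 can only make a lower bound harder to satisfy. *)
Definition minimum (A : set nat) : nat :=
  xget 0 (fun m => A m /\ forall k, A k -> m <= k).

Definition maximum (A : set nat) : nat :=
  xget 0 (fun m => A m /\ forall k, A k -> k <= m).

Definition chi_s (T : finType) (H : hypergraph T) : nat :=
  minimum (fun k => exists f : T -> 'I_k, star_coloring H f).

Definition chi_a (T : finType) (H : hypergraph T) : nat :=
  minimum (fun k => exists f : T -> 'I_k, acyclic_coloring H f).

Definition max_chi_s (r d : nat) : nat :=
  maximum (fun k => exists (n : nat) (H : hypergraph 'I_n),
    [/\ H \subset complete_hypergraph n r, max_degree H = d & chi_s H = k]).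

Definition max_chi_a (r d : nat) : nat :=
  maximum (fun k => exists (n : nat) (H : hypergraph 'I_n),
    [/\ H \subset complete_hypergraph n r, max_degree H = d & chi_a H = k]).

(* Main.v *)
From Pilot Require Import Defs.
From mathcomp Require Import all_boot all_order all_algebra.
From mathcomp Require Import all_classical all_reals all_analysis.
From mathcomp Require Import ring lra zify.
Import Order.TTheory GRing.Theory Num.Theory.
Import numFieldNormedType.Exports.
Import mathcomp.boot.fintype mathcomp.boot.finset Pilot.Defs.

Set Implicit Arguments.
Unset Strict Implicit.
Unset Printing Implicit Defensive.

(** Both chromatic numbers are bounded below through one obstruction: three
    hyperedges that pairwise meet, have no common vertex and carry exactly two
    colors form a bicolored cycle of length three, and also a bicolored
    connected subhypergraph that is not a star.  It suffices to build, for each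
    large d, an r-uniform hypergraph of maximum degree d in which every coloring
    with k colors, k ~ (d^3 / ln d)^(1/(3r-4)), has a monochromatic hyperedge or
    such a triangle.

    The hypergraph is random: among n ~ k vertices (the ratio depends on r only)
    each r-set is kept with probability 1/q.  A coloring with k colors contains
    2k disjoint monochromatic blocks of 3(r-2) vertices
    ([monochromatic_blocks]).  To every pair of blocks, one among the first k
    and one among the last k, is attached a triangle whose three hyperedges meet
    both blocks ([triangle]); if all three are kept, then either the two blocks
    have the same color and a hyperedge is monochromatic, or the triangle is
    bicolored ([triangles_force_colors]).  Distinct pairs of blocks have
    disjoint triangles, so the k^2 triangles are all missed with probability
    (1 - q^-3)^(k^2) ([no_zero_block_count]).  There are at most n^n families of
    blocks, hence a union bound succeeds as soon as k^2 / q^3 exceeds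
    n ln n + 1, that is, for q of order (k / ln k)^(1/3).  The degrees are at
    most d by an exponential moment bound ([zero_label_moment]) when d is a
    large enough multiple of the mean degree n^(r-1) / q.  Solving for k gives
    d^3 / ln d ~ k^(3r-4).

    The maximum degree must be exactly d: hyperedges are added one at a time,
    each of which raises it by at most one ([complete_to_max_degree]).  Finally
    the maxima over all hypergraphs are attained, because for r >= 3 a coloring
    that is injective on every hyperedge is a star coloring and an acyclic
    coloring, and d * r + 1 colors are enough for it ([rainbow_exists]). *)

(** * Bicolored triangles *)

Lemma card_bigcup_le (I T : finType) (A : {pred I}) (F : I -> {set T}) :
  #|\bigcup_(i in A) F i| <= \sum_(i in A) #|F i|.
Proof.
apply: (big_ind2 (fun (B : {set T}) m => #|B| <= m)) => [|B m B' m' Bm Bm'|//].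
  by rewrite cards0.
exact: leq_trans (leq_card_setU _ _) (leq_add Bm Bm').
Qed.

Lemma coverP (T : finType) (S : hypergraph T) (x : T) :
  reflect (exists2 E, E \in S & x \in E) (x \in cover S).
Proof. exact: bigcupP. Qed.

Lemma ordS3_surj (i j : 'I_3) : [\/ j = i, j = ordS i | j = ord_pred i].
Proof.
by case: i j => [[|[|[|?]]] ?] [[|[|[|?]]] ?] //;
  do ?[by constructor 1; apply: val_inj|by constructor 2; apply: val_inj
      |by constructor 3; apply: val_inj].
Qed.

Lemma is_cycle3_card (T : finType) (S : hypergraph T) :
  is_cycle 3 S -> #|S| = 3.
Proof.
by case=> E [Einj -> _ _]; rewrite card_imset // card_ord.
Qed.

Lemma is_cycle3_connected (T : finType) (S : hypergraph T) :
  is_cycle 3 S -> connected_hypergraph S.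
Proof.
case=> E [_ -> meet _] x y /coverP[_ /imsetP[i _ ->] xi].
have step u v l : u \in E l -> v \in E l ->
    connect (adjacent [set E i | i : 'I_3]) u v.
  move=> ul vl; apply: connect1; apply/existsP; exists (E l).
  by rewrite imset_f //= ul vl.
case/coverP=> _ /imsetP[j _ ->] yj.
case: (ordS3_surj i j) yj => -> yj.
- exact: step yj.
- have /eqP/set0Pn[z /setIP[zi zj]] := meet i.
  exact: connect_trans (step _ _ _ xi zi) (step _ _ _ zj yj).
- have /eqP/set0Pn[z /setIP[zj zi]] := meet (ord_pred i).
  rewrite ord_predK in zi.
  exact: connect_trans (step _ _ _ xi zi) (step _ _ _ zj yj).
Qed.

Lemma is_cycle3_not_star (T : finType) (S : hypergraph T) :
  is_cycle 3 S -> ~ is_star S.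
Proof.
case=> E [_ -> _ disj] [_ [v vE]].
have : v \in E (ord_pred ord0) :&: E ord0 :&: E (ordS ord0).
  by rewrite !inE !vE ?imset_f.
by rewrite disj inE.
Qed.

(** The obstruction common to star and acyclic colorings: a bicolored cycle of
    length three is forbidden by the latter directly, and by the former because
    it is connected without being a star.  Quantifying over all color types of
    at most [k] elements lets it be used with any smaller number of colors. *)
Definition forces_colors (T : finType) (H : hypergraph T) (k : nat) : Prop :=
  forall (C : finType) (f : T -> C), #|C| <= k -> no_monochromatic_edge H f ->
  exists S : hypergraph T, [/\ S \subset H, is_cycle 3 S & bicolored f S].

Lemma forces_colors_sub (T : finType) (H H' : hypergraph T) k :
  H \subset H' -> forces_colors H k -> forces_colors H' k.
Proof.
move=> sHH' forced C f Ck nomono.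
have [E EH|S [SH cyc bi]] := forced C f Ck; first exact/nomono/(subsetP sHH').
by exists S; split=> //; apply: fintype.subset_trans SH sHH'.
Qed.

Lemma forces_colors_acyclic (T C : finType) (H : hypergraph T) (f : T -> C) :
  forces_colors H #|C| -> ~ acyclic_coloring H f.
Proof.
move=> forced [nomono acyc].
have [S [SH cyc bi]] := forced C f (leqnn _) nomono.
exact: acyc SH cyc bi.
Qed.

Lemma forces_colors_star (T C : finType) (H : hypergraph T) (f : T -> C) :
  forces_colors H #|C| -> ~ star_coloring H f.
Proof.
move=> forced [nomono stars].
have [S [SH cyc bi]] := forced C f (leqnn _) nomono.
apply: (is_cycle3_not_star cyc); apply: stars bi => //.
  by rewrite is_cycle3_card.
exact: is_cycle3_connected.
Qed.

Lemma forces_colors_leq (T : finType) (H : hypergraph T) k k' :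
  k' <= k -> forces_colors H k -> forces_colors H k'.
Proof. by move=> k'k forced C f Ck'; apply: forced (leq_trans Ck' k'k). Qed.

(** * Colorings injective on every hyperedge *)

Definition rainbow (T C : finType) (H : hypergraph T) (f : T -> C) : Prop :=
  {in H, forall E : {set T}, {in E &, injective f}}.

(** A single hyperedge already shows three colors, so nothing is bicolored; this
    is where r >= 3 makes both chromatic numbers easy to bound from above. *)
Lemma rainbow_not_bicolored (T C : finType) (H S : hypergraph T) (f : T -> C) :
  {in H, forall E : {set T}, 3 <= #|E|} -> rainbow H f -> S \subset H ->
  S != set0 -> ~ bicolored f S.
Proof.
move=> card3 rain SH /set0Pn[E ES] bi.
have EH := subsetP SH E ES.
suff : #|E| <= #|f @: cover S| by rewrite bi leqNgt card3.
rewrite -(card_in_imset (rain E EH)) subset_leq_card // imsetS //.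
by apply/subsetP=> x xE; apply/coverP; exists E.
Qed.

Lemma rainbow_no_monochromatic (T C : finType) (H : hypergraph T) (f : T -> C) :
  {in H, forall E : {set T}, 3 <= #|E|} -> rainbow H f ->
  no_monochromatic_edge H f.
Proof.
move=> card3 rain E EH mono.
have /card_gt1P[x [y [xE yE /eqP]]] : 1 < #|E| by rewrite ltnW ?card3.
by apply; apply: rain EH _ _ xE yE (mono x y xE yE).
Qed.

Lemma rainbow_star (T C : finType) (H : hypergraph T) (f : T -> C) :
  {in H, forall E : {set T}, 3 <= #|E|} -> rainbow H f -> star_coloring H f.
Proof.
move=> card3 rain; split; first exact: rainbow_no_monochromatic.
move=> S SH S1 _ bi; case: (rainbow_not_bicolored card3 rain SH _ bi).
by rewrite -card_gt0 ltnW.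
Qed.

Lemma rainbow_acyclic (T C : finType) (H : hypergraph T) (f : T -> C) :
  {in H, forall E : {set T}, 3 <= #|E|} -> rainbow H f -> acyclic_coloring H f.
Proof.
move=> card3 rain; split; first exact: rainbow_no_monochromatic.
move=> m S m3 SH [E [Einj Sdef _ _]].
apply: rainbow_not_bicolored card3 rain SH _.
by rewrite -card_gt0 Sdef card_imset // card_ord (leq_trans _ m3).
Qed.

(** Vertices are colored one at a time; the neighbors of the current vertex
    occupy at most [b] of the [b.+1] colors. *)
Lemma greedy_coloring (T : finType) (e : rel T) (b : nat) :
  symmetric e -> (forall x, #|[set y | e x y]| <= b) ->
  exists f : T -> 'I_b.+1, forall x y, x != y -> e x y -> f x != f y.
Proof.
move=> esym edeg.
suff /(_ setT)[f fP] : forall A : {set T}, exists f : T -> 'I_b.+1,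
    {in A &, forall x y, x != y -> e x y -> f x != f y}.
  by exists f => x y; apply: fP; rewrite inE.
move=> A; move: {2}#|A| (leqnn #|A|) => m; elim: m A => [|m IHm] A.
  by rewrite leqn0 cards_eq0 => /eqP->; exists (fun=> ord0) => x y; rewrite inE.
have [->|/set0Pn[v vA] Am] := eqVneq A set0.
  by exists (fun=> ord0) => x y; rewrite inE.
have [|f fP] := IHm (A :\ v); first by rewrite (cardsD1 v) vA in Am.
have /subsetPn[c _ cfree] : ~~ (setT \subset f @: [set y | e v y]).
  apply: contraL (leq_imset_card f [set y | e v y]) => /subset_leq_card.
  by rewrite cardsT card_ord -ltnNge => /(leq_trans _); apply; rewrite ltnS.
have newP x : e v x -> c != f x.
  move=> evx; apply: contraNneq cfree => ->.
  by apply: imset_f; rewrite inE.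
exists (fun x => if x == v then c else f x) => x y xA yA xy exy.
have [xv|xv] := eqVneq x v; have [yv|yv] := eqVneq y v.
- by rewrite xv yv eqxx in xy.
- by apply: newP; rewrite -xv.
- by rewrite eq_sym; apply: newP; rewrite -yv esym.
- by apply: fP; rewrite ?inE ?xv ?yv.
Qed.

(** Greedy coloring of the graph joining the vertices that share a hyperedge.
    The bound does not depend on the number of vertices, which makes the maximum
    over all hypergraphs of a given degree exist. *)
Lemma rainbow_exists (T : finType) (H : hypergraph T) (r d : nat) :
  {in H, forall E : {set T}, #|E| <= r} -> max_degree H <= d ->
  exists f : T -> 'I_(d * r).+1, rainbow H f.
Proof.
move=> cardr degd.
have adj_sym : symmetric (adjacent H).
  by move=> x y; apply: eq_existsb => E; rewrite andbA andbAC -andbA.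
have [x|f fP] := @greedy_coloring T (adjacent H) (d * r) adj_sym.
  have [xH|xH] := boolP (x \in cover H); last first.
    rewrite (_ : [set y | _] = set0) ?cards0 //; apply/setP=> y.
    rewrite !inE; apply: contraNF xH => /existsP[E /and3P[EH xE _]].
    by apply/coverP; exists E.
  have -> : [set y | adjacent H x y] = \bigcup_(E in [set E in H | x \in E]) E.
    apply/setP=> y; rewrite inE; apply/existsP/bigcupP.
      by case=> E /and3P[EH xE yE]; exists E => //; rewrite inE EH.
    by case=> E; rewrite inE => /andP[EH xE] yE; exists E; rewrite EH xE.
  apply: leq_trans (_ : degree H x * r <= _); last first.
    by rewrite leq_mul2r (leq_trans _ degd) ?orbT // leq_bigmax_cond.
  rewrite -sum_nat_const.
  have /leq_trans : #|\bigcup_(E in [set E in H | x \in E]) E| <=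
      \sum_(E in [set E in H | x \in E]) #|E|; last first.
    by apply; apply: leq_sum => E; rewrite inE => /andP[/cardr].
  exact: card_bigcup_le.
exists f => E EH x y xE yE /eqP; apply: contraTeq => xy.
by apply: fP => //; apply/existsP; exists E; rewrite EH xE.
Qed.

(** * Lower bounds for the maximal chromatic numbers *)

Lemma minimumP (A : set nat) : (exists m, A m) ->
  A (minimum A) /\ forall k, A k -> minimum A <= k.
Proof.
move=> [m Am]; apply: (@xgetPex nat 0 (fun m => A m /\ forall k, A k -> m <= k)).
have exA : exists m, `[< A m >] by exists m; apply/asboolP.
case: (ex_minnP exA) => l /asboolP Al lmin; exists l; split=> // k Ak.
exact/lmin/asboolP.
Qed.

Lemma maximum_ge (A : set nat) (m b : nat) :
  A m -> (forall k, A k -> k <= b) -> m <= maximum A.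
Proof.
move=> Am Ab; have exA : exists m, `[< A m >] by exists m; apply/asboolP.
have bA k : `[< A k >] -> k <= b by move/asboolP/Ab.
have [|_] := @xgetPex nat 0 (fun m => A m /\ forall k, A k -> k <= m).
  case: (ex_maxnP exA bA) => l /asboolP Al lmax; exists l; split=> // k Ak.
  exact/lmax/asboolP.
exact.
Qed.

Lemma complete_card (n r : nat) (H : hypergraph 'I_n) :
  H \subset complete_hypergraph n r -> {in H, forall E : {set 'I_n}, #|E| = r}.
Proof. by move=> /subsetP Hr E /Hr; rewrite inE => /eqP. Qed.

(** The two chromatic numbers have the same shape, so the argument is made for
    an abstract notion [P] of coloring satisfied by all rainbow colorings: both
    the minimum for [H] and the maximum over all [G] are then attained, and a
    lower bound for the former is one for the latter. *)
Lemma max_min_coloring_gt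
    (P : forall n k : nat, hypergraph 'I_n -> ('I_n -> 'I_k) -> Prop)
    (r d n k : nat) (H : hypergraph 'I_n) :
  (forall m c (G : hypergraph 'I_m) (f : 'I_m -> 'I_c),
    {in G, forall E : {set 'I_m}, #|E| = r} -> rainbow G f -> P m c G f) ->
  (forall c (f : 'I_n -> 'I_c), c <= k -> ~ P n c H f) ->
  H \subset complete_hypergraph n r -> max_degree H = d ->
  k < maximum (fun c => exists (m : nat) (G : hypergraph 'I_m),
    [/\ G \subset complete_hypergraph m r, max_degree G = d
      & minimum (fun l => exists f : 'I_m -> 'I_l, P m l G f) = c]).
Proof.
move=> rainP notP Hr Hd.
have colorable m (G : hypergraph 'I_m) : G \subset complete_hypergraph m r ->
    max_degree G = d -> exists f : 'I_m -> 'I_(d * r).+1, P m _ G f.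
  move=> /complete_card Gr Gd.
  have [||f rain] := @rainbow_exists _ G r d; last by exists f; apply: rainP.
    by move=> E /Gr->.
  by rewrite Gd.
have [|[f fP] _] := @minimumP (fun l => exists f : 'I_n -> 'I_l, P n l H f).
  by exists (d * r).+1; apply: colorable.
apply: leq_trans (@maximum_ge _ _ (d * r).+1 _ _); last 2 first.
- by exists n, H; split=> //; exact: erefl.
- move=> _ [m [G [Gr Gd <-]]].
  have [|_] := @minimumP (fun l => exists f : 'I_m -> 'I_l, P m l G f).
    by exists (d * r).+1; apply: colorable.
  by apply; apply: colorable.
by rewrite ltnNge; apply/negP => chik; apply: notP fP.
Qed.

Lemma max_chi_s_gt (r d n k : nat) (H : hypergraph 'I_n) : 3 <= r ->
  H \subset complete_hypergraph n r -> max_degree H = d ->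
  forces_colors H k -> k < max_chi_s r d.
Proof.
move=> r3 Hr Hd forced.
apply: (max_min_coloring_gt
  (P := fun _ _ G f => star_coloring G f)) Hr Hd => [m c G f Gr rain|c f ck].
  by apply: rainbow_star rain => E /Gr->.
by apply: forces_colors_star; rewrite card_ord; apply: forces_colors_leq forced.
Qed.

Lemma max_chi_a_gt (r d n k : nat) (H : hypergraph 'I_n) : 3 <= r ->
  H \subset complete_hypergraph n r -> max_degree H = d ->
  forces_colors H k -> k < max_chi_a r d.
Proof.
move=> r3 Hr Hd forced.
apply: (max_min_coloring_gt
  (P := fun _ _ G f => acyclic_coloring G f)) Hr Hd => [m c G f Gr rain|c f ck].
  by apply: rainbow_acyclic rain => E /Gr->.
by apply: forces_colors_acyclic; rewrite card_ord;
  apply: forces_colors_leq forced.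
Qed.

(** * Degrees *)

Lemma card_complete_star (n r : nat) (v : 'I_n) :
  #|[set E : {set 'I_n} | (#|E| == r.+1) && (v \in E)]| = 'C(n.-1, r).
Proof.
have cardv : #|[set~ v]| = n.-1 by rewrite cardsC1 card_ord.
have vC (E : {set 'I_n}) : (E \subset [set~ v]) = (v \notin E).
  by rewrite subsetC sub1set inE.
rewrite -cardv -cards_draws -[RHS](card_in_imset (f := fun E => v |: E)).
  apply: eq_card => E; rewrite inE; apply/andP/imsetP.
    case=> /eqP Er vE; exists (E :\ v); last by rewrite setD1K.
    rewrite inE vC !inE eqxx /=; move: Er; rewrite (cardsD1 v) vE add1n.
    by case=> ->.
  case=> A; rewrite inE vC => /andP[vA /eqP Ar] ->.
  by rewrite cardsU1 vA Ar setU11.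
move=> A B; rewrite !inE !vC => /andP[vA _] /andP[vB _] eqAB.
by rewrite -(setU1K vA) eqAB setU1K.
Qed.

Lemma degree_complete (n r : nat) (v : 'I_n) :
  degree (complete_hypergraph n r.+1) v = 'C(n.-1, r).
Proof.
by rewrite -(card_complete_star r v); apply: eq_card => E; rewrite !inE.
Qed.

Lemma bin_ge_expn (n m k : nat) : 0 < k -> m * k <= n -> k ^ m <= 'C(n, m).
Proof.
move=> k0; elim: m n => [|m IHm] n; first by rewrite bin0.
case: n => [|n]; first by rewrite leqNgt muln_gt0 k0.
move=> mkn; have /IHm h : m * k <= n by rewrite -ltnS; apply: leq_trans mkn; nia.
rewrite -(leq_pmul2l (ltn0Sn m)) -mul_bin_diag expnS mulnA.
exact: leq_mul mkn h.
Qed.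

Lemma bin_le_expn (n m : nat) : 'C(n, m) <= n ^ m.
Proof.
elim: m n => [|m IHm] [|n] //.
apply: leq_trans (leq_pmull _ (ltn0Sn m)) _; rewrite -mul_bin_diag expnS.
rewrite leq_mul2l; apply: leq_trans (IHm n) _.
by have [->|m0] := posnP m; rewrite ?expn0 // leq_exp2r.
Qed.

Lemma degree_le_max (T : finType) (H : hypergraph T) (v : T) :
  degree H v <= max_degree H.
Proof.
have [vH|vH] := boolP (v \in cover H); first exact: leq_bigmax_cond.
rewrite (_ : degree H v = 0) //; apply/eqP; rewrite cards_eq0.
apply/eqP/setP=> E; rewrite !inE; apply: contraNF vH => /andP[EH vE].
by apply/coverP; exists E.
Qed.

Lemma max_degree_le (T : finType) (H : hypergraph T) (d : nat) :
  (forall v, degree H v <= d) -> max_degree H <= d.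
Proof. by move=> Hd; apply/bigmax_leqP => v _. Qed.

Lemma max_degree_setU1 (T : finType) (H : hypergraph T) (E : {set T}) :
  max_degree (E |: H) <= (max_degree H).+1.
Proof.
apply: max_degree_le => v; apply: leq_trans (_ : (degree H v).+1 <= _).
  apply: leq_trans (_ : #|E |: [set F in H | v \in F]| <= _).
    apply/subset_leq_card/fintype.subsetP => F; rewrite !inE.
    by case/andP=> /orP[->|->] // ->; rewrite orbT.
  by rewrite cardsU1 -add1n leq_add2r leq_b1.
by rewrite ltnS degree_le_max.
Qed.

(** Discrete continuity: adding a hyperedge increases the maximum degree by at
    most one, and the complete hypergraph has maximum degree at least [d].  So a
    hypergraph that is maximal among the uniform ones of maximum degree at most
    [d] has maximum degree exactly [d]. *)
Lemma complete_to_max_degree (n r d : nat) (H : hypergraph 'I_n) : 0 < n ->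
  H \subset complete_hypergraph n r.+1 -> max_degree H <= d ->
  d <= 'C(n.-1, r) ->
  exists H' : hypergraph 'I_n, [/\ H \subset H',
    H' \subset complete_hypergraph n r.+1 & max_degree H' = d].
Proof.
move=> n0 Hr Hd dN.
pose P (G : {set {set 'I_n}}) :=
  (G \subset complete_hypergraph n r.+1) && (max_degree G <= d).
have [|H' /maxsetP[/andP[H'r H'd] H'max] HH'] := @maxset_exists _ P H.
  by rewrite /P Hr.
exists H'; split=> //; apply/eqP; rewrite eqn_leq H'd leqNgt; apply/negP => lt_d.
have [/fintype.subsetP sub|/subsetPn[E Er EH']] :=
    boolP (complete_hypergraph n r.+1 \subset H').
  have H'E : H' = complete_hypergraph n r.+1.
    by apply/eqP; rewrite eqEsubset H'r; apply/fintype.subsetP.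
  move: lt_d; rewrite ltnNge H'E (leq_trans dN) //.
  by rewrite -(degree_complete r (Ordinal n0)) degree_le_max.
case/negP: EH'; rewrite -(H'max (E |: H')) ?setU11 ?subsetUr //.
rewrite /P (leq_trans (max_degree_setU1 _ _)) // andbT.
by rewrite subUset sub1set Er.
Qed.

(** * Triangles spanned by two blocks *)

Definition block_index (p : nat) : finType := ('I_3 * 'I_p.+1)%type.

(** For c = 0, 1, 2, the edge consists of the two vertices of [a] numbered c and
    c + 1 modulo 3 and of a private share of r - 2 vertices of [b], where r is
    [p.+3].  Two of the edges meet in a vertex of [a], all three have an empty
    intersection, and each one meets both blocks, which is what makes the edges
    attached to distinct pairs of blocks distinct. *)
Definition block_edge (T : finType) (p : nat) (a b : block_index p -> T)
    (c : 'I_3) : {set T} :=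
  [set a (c, ord0); a (ordS c, ord0)] :|: [set b (c, u) | u : 'I_p.+1].

Lemma ordS3_neq (c : 'I_3) : ordS c != c.
Proof. by case: c => [[|[|[|?]]] ?]. Qed.

Lemma ordSS3_neq (c : 'I_3) : ordS (ordS c) != c.
Proof. by case: c => [[|[|[|?]]] ?]. Qed.

Lemma ord_pred3_neq (c : 'I_3) : ord_pred c != c.
Proof. by case: c => [[|[|[|?]]] ?]. Qed.

Lemma ord_pred3_neqS (c : 'I_3) : ord_pred c != ordS c.
Proof. by case: c => [[|[|[|?]]] ?]. Qed.

Section BlockEdges.
Variables (T : finType) (p : nat) (a b : block_index p -> T).
Hypotheses (ainj : injective a) (binj : injective b).
Hypothesis ab : forall x y, a x != b y.

Let bNa x y : b x == a y = false.
Proof. by rewrite eq_sym; apply/negbTE. Qed.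

Lemma card_block_edge c : #|block_edge a b c| = p.+3.
Proof.
rewrite cardsU cards2 (card_imset _ (f := fun u => b (c, u))); last first.
  by move=> u v /binj[].
rewrite (_ : _ :&: _ = set0) ?cards0 ?subn0 ?card_ord; last first.
  apply/setP=> z; rewrite in_set0; apply: negbTE; apply/setIP=> -[/set2P za].
  by case/imsetP=> u _ zb; case: za => /eqP; rewrite zb bNa.
rewrite (inj_eq ainj) xpair_eqE andbT eq_sym ordS3_neq.
by rewrite add2n.
Qed.

Lemma mem_block_edge_b c c' u : (b (c, u) \in block_edge a b c') = (c == c').
Proof.
rewrite !inE !bNa /=; apply/imsetP/eqP => [[v _ /binj[]] //|->].
by exists u.
Qed.

Lemma mem_block_edge_a c c' :
  (a (c, ord0) \in block_edge a b c') = (c == c') || (c == ordS c').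
Proof.
have /negbTE notb : a (c, ord0) \notin [set b (c', u) | u : 'I_p.+1].
  by apply/imsetP => -[v _ /eqP]; apply/negP.
by rewrite inE notb orbF !inE !(inj_eq ainj) !xpair_eqE eqxx !andbT.
Qed.

Lemma block_edge_inj : injective (block_edge a b).
Proof.
move=> c c' eqE; have := mem_block_edge_b c c ord0.
by rewrite eqE mem_block_edge_b eqxx => /eqP.
Qed.

Lemma block_edges_cycle : is_cycle 3 [set block_edge a b c | c : 'I_3].
Proof.
exists (block_edge a b); split=> // [|c|c]; first exact: block_edge_inj.
  apply/eqP/set0Pn; exists (a (ordS c, ord0)); rewrite inE !mem_block_edge_a.
  by rewrite !eqxx orbT.
apply/setP=> z; rewrite in_set0; apply: negbTE; apply/setIP=> -[/setIP[]].
have bE e u : z = b (e, u) -> z \in block_edge a b (ord_pred c) ->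
    z \in block_edge a b c -> False.
  move=> ->; rewrite !mem_block_edge_b => /eqP-> /eqP/eqP.
  by rewrite (negbTE (ord_pred3_neq c)).
move=> z1 z2; rewrite /block_edge !inE => /orP[/orP[]/eqP za|/imsetP[u _ za]].
- move: z1; rewrite za mem_block_edge_a ord_predK.
  by rewrite (negbTE (ordS3_neq c)) orbF eq_sym (negbTE (ord_pred3_neqS c)).
- move: z2; rewrite za mem_block_edge_a (inj_eq (can_inj (@ordSK _))).
  by rewrite (negbTE (ordS3_neq c)) orbF (negbTE (ordSS3_neq c)).
- exact: bE za z1 z2.
Qed.

Lemma block_edges_bicolored (C : finType) (f : T -> C) (x y : C) :
  (forall i, f (a i) = x) -> (forall i, f (b i) = y) -> x != y ->
  bicolored f [set block_edge a b c | c : 'I_3].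
Proof.
move=> fa fb xy; rewrite /bicolored (_ : _ @: _ = [set x; y]) ?cards2 ?xy //.
have aE : a (ord0, ord0) \in cover [set block_edge a b c | c : 'I_3].
  apply/coverP; exists (block_edge a b ord0); first exact: imset_f.
  by rewrite mem_block_edge_a eqxx.
have bE : b (ord0, ord0) \in cover [set block_edge a b c | c : 'I_3].
  apply/coverP; exists (block_edge a b ord0); first exact: imset_f.
  by rewrite mem_block_edge_b.
apply/setP=> z; apply/imsetP/set2P.
  case=> w /coverP[_ /imsetP[c _ ->]] /[!inE]
    /orP[/orP[]/eqP->|/imsetP[u _ ->]] ->.
  - by left; rewrite fa.
  - by left; rewrite fa.
  - by right; rewrite fb.
by case=> ->; [exists (a (ord0, ord0))|exists (b (ord0, ord0))]; rewrite ?fa ?fb.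
Qed.

End BlockEdges.

(** The left and right copies of ['I_t] keep the two roles of a block apart, so
    that a pair of blocks determines a single triangle. *)
Definition block_family (T : finType) (t p : nat) : finType :=
  {ffun ('I_t + 'I_t) * block_index p -> T}.

Definition triangle (T : finType) (t p : nat) (g : block_family T t p)
    (ij : 'I_t * 'I_t) (c : 'I_3) : {set T} :=
  block_edge (fun x => g (inl ij.1, x)) (fun x => g (inr ij.2, x)) c.

Section Triangles.
Variables (T : finType) (t p : nat) (g : block_family T t p).
Hypothesis ginj : injective g.

Let gab i j x y : g (inl i, x) != g (inr j, y).
Proof. by rewrite (inj_eq ginj). Qed.

Let ga i : injective (fun x => g (inl i, x)).
Proof. by move=> x y /ginj[]. Qed.

Let gb i : injective (fun x => g (inr i, x)).
Proof. by move=> x y /ginj[]. Qed.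

Lemma card_triangle ij c : #|triangle g ij c| = p.+3.
Proof. exact: card_block_edge. Qed.

(** An edge contains the vertex numbered c of its left block and the share c of
    its right block, hence it determines the pair of blocks and c. *)
Lemma triangle_inj ij ij' c c' :
  triangle g ij c = triangle g ij' c' -> ij = ij' /\ c = c'.
Proof.
case: ij ij' => [i j] [i' j'] eqE.
have : g (inl i, (c, ord0)) \in triangle g (i', j') c'.
  by rewrite -eqE; rewrite mem_block_edge_a ?eqxx.
have : g (inr j, (c, ord0)) \in triangle g (i', j') c'.
  by rewrite -eqE; rewrite mem_block_edge_b ?eqxx.
rewrite !inE !(inj_eq ginj) /= => /imsetP[u _ /ginj[-> -> _]].
case/orP=> [/orP[]/andP[/eqP[->]]|/imsetP[v _ /ginj]] //.
Qed.

End Triangles.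

(** As long as more than [#|C| * #|J|] vertices are free, some color class has
    [#|J|] free vertices, from which one more block is taken. *)
Lemma monochromatic_blocks (T C J : finType) (f : T -> C) (t0 : T) (m : nat) :
  0 < #|J| -> (#|C| + m) * #|J| <= #|T| ->
  exists B : nat -> J -> T,
    (forall i j x y, i < m -> j < m -> B i x = B j y -> i = j /\ x = y) /\
    (forall i x y, i < m -> f (B i x) = f (B i y)).
Proof.
move=> J0; elim: m => [_|m IHm cardT]; first by exists (fun _ _ => t0).
have [|B [Binj Bmono]] := IHm.
  by apply: leq_trans cardT; rewrite leq_mul2r leq_add2l leqnSn orbT.
pose used := [set B x.1 x.2 | x : 'I_m * J].
have free_card : #|C| * #|J| < #|~: used|.
  have : #|used| <= m * #|J|.
    by apply: leq_trans (leq_imset_card _ _) _; rewrite card_prod card_ord.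
  by rewrite -(leq_add2r #|~: used|) cardsC; nia.
have [c cJ] : exists c, #|J| <= #|[set x in ~: used | f x == c]|.
  apply/existsP; apply: contraLR free_card => /existsPn small.
  rewrite -leqNgt -sum1_card (partition_big f xpredT) //=.
  rewrite -sum_nat_const; apply: leq_sum => c _.
  apply: leq_trans (ltnW _); last by rewrite ltnNge; apply: small c.
  by rewrite -sum1_card; apply: eq_leq; apply: eq_bigl => x; rewrite !inE.
pose new (x : J) : T := enum_val (widen_ord cJ (enum_rank x)).
have newP x : new x \in [set x in ~: used | f x == c] by exact: enum_valP.
have new_used i x y : i < m -> B i x <> new y.
  move=> im eqB; have := newP y; rewrite -eqB !inE => /andP[/negP[]] //.
  by apply/imsetP; exists (Ordinal im, x).
exists (fun i => if i == m then new else B i); split=> [i j x y|i x y].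
  rewrite !ltnS [i <= m]leq_eqVlt [j <= m]leq_eqVlt.
  have [-> _|im /= lim] := eqVneq i m; have [-> _|jm /= ljm] := eqVneq j m.
  - by move/enum_val_inj => /(congr1 val) /= /ord_inj /enum_rank_inj.
  - by move/esym/new_used; case.
  - by move/new_used; case.
  - exact: Binj.
rewrite ltnS [i <= m]leq_eqVlt; have [_ _|_ /=] := eqVneq i m; last exact: Bmono.
by have := newP x; have := newP y; rewrite !inE => /andP[_ /eqP->] /andP[_ /eqP->].
Qed.

(** The family found by [monochromatic_blocks] is split into [k] left and [k]
    right blocks.  A kept triangle on two blocks of the same color would consist
    of monochromatic hyperedges, so the two blocks have different colors. *)
Lemma triangles_force_colors (n k p : nat) (H : hypergraph 'I_n) : 0 < k ->
  3 * k * #|block_index p| <= n ->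
  (forall g : block_family 'I_n k p, injective g ->
    exists ij, forall c, triangle g ij c \in H) ->
  forces_colors H k.
Proof.
move=> k0 kn Htri C f Ck nomono.
have J0 : 0 < #|block_index p| by rewrite card_prod !card_ord.
have n0 : 0 < n by apply: leq_trans kn; rewrite !muln_gt0 k0.
have [|B [Binj Bmono]] :=
    monochromatic_blocks f (Ordinal n0) (m := k + k) J0.
  by rewrite card_ord; apply: leq_trans kn; rewrite leq_mul2r; nia.
pose pos (i : 'I_k + 'I_k) : nat :=
  match i with inl i => i | inr j => k + j end.
have posk i : pos i < k + k.
  by case: i => i /=; rewrite ?ltn_add2l // (leq_trans (ltn_ord i)) ?leq_addr.
have pos_inj : injective pos.
  move=> [i|i] [j|j] /= eqij; do ?congr (_ _).
  - exact: ord_inj.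
  - by have := ltn_ord i; rewrite eqij ltnNge leq_addr.
  - by have := ltn_ord j; rewrite -eqij ltnNge leq_addr.
  - by apply/ord_inj/(@addnI k).
pose g : block_family 'I_n k p := [ffun x => B (pos x.1) x.2].
have ginj : injective g.
  by move=> [i x] [j y]; rewrite !ffunE => /Binj[]//= /pos_inj-> ->.
have gmono i x y : f (g (i, x)) = f (g (i, y)) by rewrite !ffunE; apply: Bmono.
have [[i j] triH] := Htri g ginj.
exists [set triangle g (i, j) c | c : 'I_3]; split.
- by apply/fintype.subsetP => _ /imsetP[c _ ->].
- apply: block_edges_cycle => [x y /ginj[]|x y /ginj[]|x y] //.
  by rewrite (inj_eq ginj).
pose x0 : block_index p := (ord0, ord0).
apply: (@block_edges_bicolored _ _ _ _ _ _ _ _ f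
  (f (g (inl i, x0))) (f (g (inr j, x0)))).
- by move=> x y /ginj[].
- by move=> x y /ginj[].
- by move=> x y; rewrite (inj_eq ginj).
- by move=> x; apply: gmono.
- by move=> x; apply: gmono.
apply/eqP => eqf; case: (nomono _ (triH ord0)) => u v.
have const w : w \in triangle g (i, j) ord0 -> f w = f (g (inl i, x0)).
  rewrite !inE => /orP[/orP[]/eqP->|/imsetP[z _ ->]]; try exact: gmono.
  by rewrite eqf; apply: gmono.
by move=> /const-> /const->.
Qed.

(** * Counting labelings *)

(** Exponential Markov inequality for a uniform random labeling: the expectation
    of 2 to the number of zero labels in [D] is [(q.+2 / q.+1) ^ #|D|], as the
    labels are independent. *)
Lemma zero_label_moment (X : finType) (q d : nat) (D : {set X}) :
  #|[set w : {ffun X -> 'I_q.+1} | d < #|[set x in D | w x == ord0]|]|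
    * 2 ^ d.+1 * q.+1 ^ #|D| <= q.+1 ^ #|X| * q.+2 ^ #|D|.
Proof.
pose F (x : X) (y : 'I_q.+1) := if (x \in D) && (y == ord0) then 2 else 1.
have momentE : \sum_(w : {ffun X -> 'I_q.+1}) 2 ^ #|[set x in D | w x == ord0]|
    = q.+2 ^ #|D| * q.+1 ^ #|~: D|.
  transitivity (\prod_x \sum_y F x y).
    rewrite bigA_distr_bigA; apply: eq_bigr => w _.
    rewrite -big_mkcond /= -prod_nat_const; apply: eq_bigl => x.
    by rewrite inE.
  rewrite (bigID (mem D)) /= -!prod_nat_const; congr (_ * _).
    apply: eq_bigr => x xD; rewrite (bigD1 ord0) //= {1}/F xD eqxx.
    rewrite (eq_bigr (fun=> 1)) => [|y /negbTE y0]; last by rewrite /F y0 andbF.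
    by rewrite sum1_card cardC1 card_ord.
  apply: eq_big => [x|x xD]; first by rewrite inE.
  rewrite (eq_bigr (fun=> 1)) => [|y _]; last by rewrite /F (negbTE xD).
  by rewrite sum1_card card_ord.
rewrite -(cardsC D) expnD mulnC -[leqRHS]mulnA leq_mul2l.
apply/orP; right; rewrite [leqRHS]mulnC -momentE -sum_nat_const big_mkcond /=.
apply: leq_sum => w _; rewrite inE; case: ifP => // dw.
by rewrite leq_exp2l.
Qed.

(** For a uniform random labeling, the events that the block [e i] is labeled by
    zeros only are independent, so all blocks of [s] avoid them with probability
    at most [(1 - q.+1 ^- #|K|) ^ size s].  In the induction, replacing the
    labels of the new block by zeros shows that at least a proportion
    [q.+1 ^- #|K|] of the labelings avoiding the other blocks hits the new one:
    the operation keeps the labels of the other blocks, and it can be undone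
    knowing the old labels of the new block. *)
Lemma no_zero_block_count (X P K : finType) (q : nat) (e : P -> K -> X)
    (s : seq P) :
  (forall i j x y, e i x = e j y -> i = j /\ x = y) -> uniq s ->
  #|[set w : {ffun X -> 'I_q.+1} |
      all (fun i => ~~ [forall x, w (e i x) == ord0]) s]|
    * (q.+1 ^ #|K|) ^ size s <= q.+1 ^ #|X| * (q.+1 ^ #|K| - 1) ^ size s.
Proof.
move=> einj; elim: s => [|i s IHs] /=.
  by rewrite !expn0 !muln1 -[q.+1 in leqRHS]card_ord -card_ffun max_card.
case/andP=> is_notin us; have {IHs us} := IHs us.
set avoid := fun w : {ffun X -> 'I_q.+1} => all _ s.
pose hit (w : {ffun X -> 'I_q.+1}) := [forall x, w (e i x) == ord0].
set Q := q.+1 ^ #|K| => IHs.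
have Q0 : 0 < Q by rewrite expn_gt0.
have split_card : #|[set w | ~~ hit w && avoid w]| +
    #|[set w | hit w && avoid w]| = #|[set w | avoid w]|.
  rewrite -(cardsID [set w | hit w] [set w | avoid w]) addnC.
  by congr (_ + _); apply: eq_card => w; rewrite !inE 1?andbC.
have hit_many : #|[set w | avoid w]| <= Q * #|[set w | hit w && avoid w]|.
  pose clear (w : {ffun X -> 'I_q.+1}) : {ffun X -> 'I_q.+1} :=
    [ffun z => if [exists x, z == e i x] then ord0 else w z].
  pose h (w : {ffun X -> 'I_q.+1}) := ([ffun x => w (e i x)] : {ffun K -> 'I_q.+1},
    clear w).
  have hinj : injective h.
    move=> w w' [/ffunP eq_e /ffunP eq_c]; apply/ffunP => z.
    have [/existsP[x /eqP->]|zN] := boolP [exists x, z == e i x].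
      by have := eq_e x; rewrite !ffunE.
    by have := eq_c z; rewrite !ffunE (negbTE zN).
  have -> : Q = #|{ffun K -> 'I_q.+1}| by rewrite card_ffun card_ord.
  rewrite -(card_imset _ hinj) -cardsT -cardsX.
  apply/subset_leq_card/fintype.subsetP => _ /imsetP[w /[!inE] aw ->].
  rewrite /=; apply/andP; split.
    by apply/forallP => x; rewrite ffunE; case: existsP => // -[]; exists x.
  apply/allP=> j js; have := allP aw j js; apply: contra => /forallP cj.
  apply/forallP => x; have := cj x; rewrite ffunE; case: existsP => //.
  by case=> y /eqP/einj[ji _]; case/negP: is_notin; rewrite -ji.
rewrite !expnS; move: split_card hit_many IHs.
set A := #|_|; set B := #|_|; set C := #|_| => <- hit_many IHs.
have step : A * Q <= (Q - 1) * (A + B) by nia.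
apply: (@leq_trans ((Q - 1) * ((A + B) * Q ^ size s))); first by nia.
by rewrite [leqRHS]mulnCA leq_mul2l IHs orbT.
Qed.

(** * The random hypergraph *)

Local Open Scope ring_scope.

Lemma expRN1_lt_half (R : realType) : expR (-1 : R) < 1 / 2.
Proof.
rewrite expRN div1r ltf_pV2 ?posrE ?expR_gt0 //.
by have := @expR_gt1Dx R 1 (oner_neq0 _); lra.
Qed.

Lemma expR_half_le2 (R : realType) : expR (1 / 2 : R) <= 2.
Proof.
have h : 1 / 2 <= expR (- (1 / 2) : R) by have := expR_ge1Dx (- (1 / 2) : R); lra.
rewrite -[leLHS]invrK -expRN -[leRHS]invrK lef_pV2 ?posrE ?expR_gt0 ?invr_gt0 //.
by rewrite -[leLHS]mul1r.
Qed.

(** Less than half a vertex of degree above [d] is expected: the moment is at most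
    [expR (N / q.+1) <= expR (d / 4)], while [2 ^+ d.+1] exceeds
    [expR (d.+1 / 2)]. *)
Lemma degree_tail_small (R : realType) (n q N d : nat) : (0 < n)%N ->
  (4 * N <= q.+1 * d)%N -> 4 * (1 + ln n%:R) <= d%:R :> R ->
  n%:R * (q.+2%:R / q.+1%:R) ^+ N / 2 ^+ d.+1 < 1 / 2 :> R.
Proof.
move=> n0 qd lnd; have nR : 0 < n%:R :> R by rewrite ltr0n.
have qR : 0 < q.+1%:R :> R by [].
have d2 : expR (1 / 2 * d.+1%:R) <= 2 ^+ d.+1 :> R.
  by rewrite expRM_natr lerXn2r ?nnegrE ?expR_ge0 ?expR_half_le2.
have qN : (q.+2%:R / q.+1%:R) ^+ N <= expR (d%:R / 4) :> R.
  apply: (@le_trans _ _ (expR (1 / q.+1%:R * N%:R))).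
    rewrite expRM_natr lerXn2r ?nnegrE ?expR_ge0 ?divr_ge0 //.
    apply: le_trans (expR_ge1Dx _); rewrite ler_pdivrMr // mulrDl.
    by rewrite divfK ?gt_eqF // mul1r -natr1.
  rewrite ler_expR div1r mulrC ler_pdivrMr // mulrAC ler_pdivlMr //.
  by rewrite -!natrM ler_nat mulnC [leqRHS]mulnC.
rewrite ltr_pdivrMr ?exprn_gt0 //.
apply: (@le_lt_trans _ _ (expR (ln n%:R + d%:R / 4))).
  by rewrite expRD lnK ?posrE // ler_pM2l.
apply: (@le_lt_trans _ _ (expR (-1) * expR (1 / 2 * d.+1%:R))).
  by rewrite -expRD ler_expR -[d.+1%:R]natr1; lra.
apply: (@le_lt_trans _ _ (expR (-1) * 2 ^+ d.+1)); first by rewrite ler_pM2l ?expR_gt0.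
by rewrite ltr_pM2r ?exprn_gt0 // expRN1_lt_half.
Qed.

(** The union bound over the at most [n ^ n = expR (n * ln n)] families of
    blocks, each of which has its [m] triangles missed with probability at most
    [expR (- m / q.+1 ^ 3)]. *)
Lemma avoidance_small (R : realType) (n q m : nat) : (0 < n)%N ->
  q.+1%:R ^+ 3 * (n%:R * ln n%:R + 1) <= m%:R :> R ->
  n%:R ^+ n * (1 - 1 / q.+1%:R ^+ 3) ^+ m < 1 / 2 :> R.
Proof.
move=> n0 qm; have nR : 0 < n%:R :> R by rewrite ltr0n.
have Q0 : 0 < q.+1%:R ^+ 3 :> R by rewrite exprn_gt0.
apply: le_lt_trans (expRN1_lt_half R).
apply: (@le_trans _ _ (expR (n%:R * ln n%:R) * expR (- (1 / q.+1%:R ^+ 3) * m%:R))).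
  rewrite expRM_natl lnK ?posrE // ler_pM2l ?exprn_gt0 // expRM_natr.
  rewrite lerXn2r ?nnegrE ?expR_ge0 ?expR_ge1Dx //.
  by rewrite subr_ge0 ler_pdivrMr // mul1r exprn_ege1 // ler1n.
rewrite -expRD ler_expR mulNr lerBlDr addrC lerBrDr.
by rewrite div1r [leRHS]mulrC ler_pdivlMr // mulrC.
Qed.

(** A set of size [p.+3] is a hyperedge when its label in ['I_q.+1] is zero.
    The labelings with a vertex of too large degree, and those that miss all the
    triangles of some family of blocks, each make up less than one half. *)
Lemma sparse_hypergraph_exists (R : realType) (n k p q d : nat) :
  (0 < n)%N -> (2 * k * #|block_index p| <= n)%N ->
  (4 * 'C(n.-1, p.+2) <= q.+1 * d)%N -> 4 * (1 + ln n%:R) <= d%:R :> R ->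
  q.+1%:R ^+ 3 * (n%:R * ln n%:R + 1) <= (k * k)%:R :> R ->
  exists H : hypergraph 'I_n, [/\ H \subset complete_hypergraph n p.+3,
    (max_degree H <= d)%N
    & forall g : block_family 'I_n k p, injective g ->
        exists ij, forall c, triangle g ij c \in H].
Proof.
move=> n0 kn qd lnd qk; set N := 'C(n.-1, p.+2) in qd.
pose X : finType := {set 'I_n}; pose W := {ffun X -> 'I_q.+1}.
pose H (w : W) : hypergraph 'I_n :=
  [set E in complete_hypergraph n p.+3 | w E == ord0].
pose heavy v := [set w : W | (d < degree (H w) v)%N].
pose missed (g : block_family 'I_n k p) := [set w : W |
  all (fun ij => ~~ [forall c, w (triangle g ij c) == ord0])
      (enum {: 'I_k * 'I_k})].
pose bad := (\bigcup_(v in 'I_n) heavy v)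
  :|: (\bigcup_(g in [pred g : block_family 'I_n k p | injectiveb g]) missed g).
have W0 : 0 < #|{: W}|%:R :> R by rewrite card_ffun card_ord ltr0n expn_gt0.
suff : (#|bad| < #|{: W}|)%N.
  rewrite ltnNge => /negP few.
  have /subsetPn[w _] : ~~ (setT \subset bad).
    by apply/negP => /subset_leq_card; rewrite cardsT.
  rewrite !inE negb_or => /andP[/bigcupP light /bigcupP hit].
  exists (H w); split.
  - by apply/fintype.subsetP => E; rewrite !inE => /andP[].
  - apply: max_degree_le => v; rewrite leqNgt; apply/negP => dv.
    by apply: light; exists v; rewrite ?inE.
  - move=> g ginj.
    have : ~~ all (fun ij => ~~ [forall c, w (triangle g ij c) == ord0])
      (enum {: 'I_k * 'I_k}).
      apply/negP => miss; apply: hit; exists g; rewrite ?inE //.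
      exact/injectiveP.
    case/allPn => ij _ /negbNE/forallP hit_ij; exists ij => c.
    by rewrite !inE card_triangle ?eqxx ?hit_ij.
have heavy_card v : #|heavy v|%:R <=
    #|{: W}|%:R * ((q.+2%:R / q.+1%:R) ^+ N / 2 ^+ d.+1) :> R.
  have := @zero_label_moment X q d
    [set E : {set 'I_n} | (#|E| == p.+3) && (v \in E)].
  rewrite card_complete_star -/N => tail.
  rewrite expr_div_n mulrA ler_pdivlMr ?exprn_gt0 // mulrA.
  rewrite ler_pdivlMr ?exprn_gt0 ?ltr0n // -!natrX -!natrM ler_nat.
  rewrite card_ffun card_ord; apply: leq_trans tail.
  rewrite leq_mul2r leq_mul2r subset_leq_card ?orbT //.
  apply/fintype.subsetP => w; rewrite !inE => /leq_trans; apply.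
  by apply: subset_leq_card; apply/fintype.subsetP => E; rewrite !inE andbAC.
have missed_card (g : block_family 'I_n k p) : injectiveb g -> #|missed g|%:R <=
    #|{: W}|%:R * (1 - 1 / q.+1%:R ^+ 3) ^+ (k * k) :> R.
  move/injectiveP => ginj.
  have := @no_zero_block_count X ('I_k * 'I_k)%type 'I_3 q (triangle g) _
    (triangle_inj ginj) (enum_uniq {: 'I_k * 'I_k}).
  rewrite -cardE card_prod !card_ord => count.
  have Q0 : 0 < q.+1%:R ^+ 3 :> R by rewrite exprn_gt0.
  have -> : 1 - 1 / q.+1%:R ^+ 3 = (q.+1 ^ 3 - 1)%:R / q.+1%:R ^+ 3 :> R.
    by rewrite natrB ?expn_gt0 // natrX mulrBl divff // lt0r_neq0.
  rewrite expr_div_n mulrA.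
  rewrite ler_pdivlMr ?exprn_gt0 // -!natrX -!natrM.
  by rewrite ler_nat card_ffun card_ord.
have family_card : #|{: block_family 'I_n k p}|%:R <= n%:R ^+ n :> R.
  rewrite card_ffun card_prod card_sum !card_ord -natrX ler_nat.
  by rewrite leq_pexp2l // addnn -mul2n.
rewrite -(ltr_nat R).
apply: (@le_lt_trans _ _ (\sum_(v in 'I_n) #|heavy v|%:R +
  \sum_(g in [pred g : block_family 'I_n k p | injectiveb g]) #|missed g|%:R)).
  rewrite -!natr_sum -natrD ler_nat.
  by apply: leq_trans (leq_card_setU _ _) (leq_add _ _); apply: card_bigcup_le.
apply: (@lt_le_trans _ _ (#|{: W}|%:R * (1 / 2) + #|{: W}|%:R * (1 / 2))); last by lra.
apply: ltr_leD.
  apply: (@le_lt_trans _ _ (\sum_(v in 'I_n)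
      #|{: W}|%:R * ((q.+2%:R / q.+1%:R) ^+ N / 2 ^+ d.+1))).
    by apply: ler_sum => v _; apply: heavy_card.
  rewrite sumr_const card_ord -[ltLHS]mulr_natl mulrCA ltr_pM2l // mulrA.
  exact: degree_tail_small.
apply: (@le_trans _ _
    (\sum_(g in [pred g : block_family 'I_n k p | injectiveb g])
      #|{: W}|%:R * (1 - 1 / q.+1%:R ^+ 3) ^+ (k * k))).
  by apply: ler_sum => g; rewrite inE => ginj; apply: missed_card.
have p_ge0 : 0 <= (1 - 1 / q.+1%:R ^+ 3) ^+ (k * k) :> R.
  rewrite exprn_ge0 // subr_ge0 ler_pdivrMr ?exprn_gt0 // mul1r.
  by rewrite exprn_ege1 // ler1n.
rewrite sumr_const -[leLHS]mulr_natl mulrCA ler_pM2l //.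
apply: le_trans (ltW (avoidance_small n0 qk)).
apply: ler_wpM2r => //; apply: le_trans family_card.
by rewrite ler_nat max_card.
Qed.

(** * Choice of the parameters *)

(** The value that makes the chain of inequalities of
    [forcing_hypergraph_exists] close: 375 is 5 ^ 3 * 3, where 5 comes from
    rounding q up and 3 from bounding [n * ln n + 1] by [3 * n * ln d]; the
    base of the power is n / k, and N ^ 3 * n is at most n ^ (3 p + 7). *)
Definition density_constant (p : nat) : nat :=
  375 * (3 * #|block_index p|) ^ (3 * p + 7).

(** Here r is [p.+3], so that 3r - 4 is [3 * p + 5].  With n a multiple of k and
    q the least integer for which the mean degree is below d / 4, the union bound
    asks for [q ^ 3 * n * ln n] to be of order at most [k ^ 2]; as q is of order
    n ^ (r - 1) / d, this amounts to [k ^ (3r - 4) * ln d] being of order at most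
    [d ^ 3].  The bound [d <= k ^ p.+2] ensures that the complete hypergraph has
    degrees above [d]. *)
Lemma forcing_hypergraph_exists (R : realType) (p d k : nat) :
  (0 < k)%N -> (d <= k ^ p.+2)%N -> (3 * #|block_index p| <= d)%N ->
  1 <= ln d%:R :> R -> 12 * ln d%:R <= d%:R :> R ->
  (density_constant p)%:R * k%:R ^+ (3 * p + 5) * ln d%:R <= d%:R ^+ 3 :> R ->
  exists (n : nat) (H : hypergraph 'I_n),
    [/\ H \subset complete_hypergraph n p.+3, max_degree H = d
      & forces_colors H k].
Proof.
move=> k0 dk sd ln1 ln12 Kd; set s := #|block_index p| in sd.
have s_gt : (p.+3 <= 3 * s)%N by rewrite /s card_prod !card_ord; lia.
have d0 : (0 < d)%N by apply: leq_trans sd; apply: leq_trans s_gt.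
have dR : 0 < d%:R :> R by rewrite ltr0n.
pose n := (3 * k * s)%N.
have n0 : (0 < n)%N by rewrite /n; nia.
pose N := 'C(n.-1, p.+2).
have kN : (k ^ p.+2 <= N)%N.
  by apply: bin_ge_expn => //; rewrite -ltnS prednK // /n; nia.
have dN := leq_trans dk kN.
have Nn : (N <= n ^ p.+2)%N.
  by apply: leq_trans (bin_le_expn _ _) _; rewrite leq_exp2r // leq_pred.
have kd : (k <= d)%N.
  have : (k ^ (3 * p + 5) <= d ^ (3 * p + 5))%N.
    apply: (@leq_trans (d ^ 3)); last by rewrite leq_pexp2l //; lia.
    rewrite -(ler_nat R) !natrX; apply: le_trans Kd.
    rewrite mulrAC ler_peMl ?exprn_ge0 // mulr_ege1 //.
    by rewrite ler1n muln_gt0 expn_gt0; lia.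
  by rewrite leq_exp2r //; lia.
have lnn : ln n%:R <= 2 * ln d%:R :> R.
  rewrite mulr_natl -lnXn // ler_ln ?posrE ?exprn_gt0 ?ltr0n //.
  by rewrite -natrX ler_nat /n; nia.
(* The number of labels is q.+1, hence the rounding up. *)
pose q := (4 * N %/ d)%N.
have qd : (4 * N <= q.+1 * d)%N by rewrite ltnW // ltn_ceil.
have qN : (q.+1 * d <= 5 * n ^ p.+2)%N.
  by have := leq_trunc_div (4 * N) d; rewrite -/q; nia.
have [|||||H [Hr Hd Htri]] := @sparse_hypergraph_exists R n k p q d.
- by [].
- by rewrite /n !leq_mul.
- exact: qd.
- by lra.
- rewrite -(ler_pM2r (exprn_gt0 3 dR)) mulrAC -exprMn -natrM.
  have nln : n%:R * ln n%:R + 1 <= n%:R * (3 * ln d%:R) :> R.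
    have n1 : 1 <= n%:R :> R by rewrite ler1n.
    by nra.
  apply: (@le_trans _ _ ((5 * n ^ p.+2)%:R ^+ 3 * (n%:R * (3 * ln d%:R)))).
    apply: ler_pM => //.
    - by rewrite addr_ge0 // mulr_ge0 // ln_ge0 // ler1n.
    - by rewrite lerXn2r ?nnegrE // ler_nat.
  apply: le_trans (_ : (k * k)%:R *
      ((density_constant p)%:R * k%:R ^+ (3 * p + 5) * ln d%:R) <= _).
    rewrite !mulrA ler_wpM2r ?(le_trans _ ln1) // -!natrX -!natrM ler_nat.
    apply/eq_leq; rewrite /density_constant -/s /n expnMn -expnM.
    rewrite (_ : 3 * k * s = (3 * s) * k)%N; last by lia.
    rewrite !expnMn (_ : p.+2 * 3 = (3 * p + 5).+1)%N; last by lia.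
    rewrite (_ : 3 * p + 7 = (3 * p + 5).+2)%N; last by lia.
    by rewrite !expnS expn0; set B := expn 3 _; set C := expn s _; ring.
  by rewrite ler_wpM2l.
have forced : forces_colors H k by apply: triangles_force_colors Htri.
have [H' [HH' H'r H'd]] := complete_to_max_degree n0 Hr Hd dN.
by exists n, H'; split=> //; apply: forces_colors_sub forced.
Qed.

Local Open Scope classical_set_scope.
Local Open Scope ring_scope.

(** [d = expR (y / m.+1) ^+ m.+1 >= (y / m.+1) ^+ m.+1] for [y = ln d], so [d]
    dominates one more power of [y] than needed, and the constant is absorbed
    once [L * y] exceeds it. *)
Lemma ln_power_le (R : realType) (L : R) (m : nat) : 0 < L ->
  \forall d \near \oo, (L * ln d%:R) ^+ m <= d%:R :> R.
Proof.
move=> L0; pose M : R := (L * m.+1%:R) ^+ m.+1.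
have M0 : 0 < M by rewrite exprn_gt0 // mulr_gt0.
exists (Num.truncn (expR (M / L))).+1 => // d /= dM; set y := ln d%:R.
have d0 : 0 < d%:R :> R by rewrite ltr0n (leq_trans _ dM).
have yM : M <= L * y.
  rewrite mulrC -ler_pdivrMr // -ler_expR lnK ?posrE //.
  by apply/ltW/(lt_le_trans (truncnS_gt _)); rewrite ler_nat.
have y0 : 0 < L * y by apply: lt_le_trans yM.
have y_ge0 : 0 <= y by rewrite -(pmulr_rge0 _ L0) ltW.
rewrite -(ler_pM2l y0) -exprS.
apply: (@le_trans _ _ (M * d%:R)); last by rewrite ler_pM2r.
have -> : d%:R = expR (y / m.+1%:R) ^+ m.+1.
  by rewrite -expRM_natr divfK // lnK ?posrE.
rewrite -exprMn lerXn2r ?nnegrE ?mulr_ge0 ?expR_ge0 ?(ltW L0) //.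
rewrite -mulrA ler_pM2l // mulrC -ler_pdivrMr //.
by apply: le_trans (expR_ge1Dx _); rewrite lerDr ler01.
Qed.

(** k is the integer part of [z = (d ^ 3 / (K * ln d)) `^ (1 / e)], e = 3r - 4.
    The number of colors forced is [k.+1 > z], which is the required order of
    magnitude. *)
Lemma forcing_hypergraph_eventually (R : realType) (p : nat) :
  exists2 c : R, 0 < c & \forall d \near \oo, exists (k n : nat)
    (H : hypergraph 'I_n),
    [/\ H \subset complete_hypergraph n p.+3, max_degree H = d,
      forces_colors H k
    & c * (d%:R ^+ 3 / ln d%:R) `^ (1 / (3 * p.+3%:R - 4)) <= k.+1%:R].
Proof.
pose e := (3 * p + 5)%N; pose K : R := (density_constant p)%:R.
have eE : 3 * p.+3%:R - 4 = e%:R :> R.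
  by rewrite /e natrD natrM -[in LHS]addn3 natrD; lra.
have e_gt0 : (0 < e)%N by rewrite /e addnS.
have e0 : 0 < e%:R :> R by rewrite ltr0n.
have K12 : 12 <= K.
  rewrite ler_nat /density_constant card_prod !card_ord.
  by apply: (@leq_trans (375 * 1)) => //; rewrite leq_mul2l expn_gt0; lia.
have K0 : 0 < K by lra.
pose L : R := 2 ^+ e * K.
have KL : K <= L by rewrite ler_peMl ?(ltW K0) // exprn_ege1 // ler1n.
have L0 : 0 < L by lra.
exists (K^-1 `^ (1 / e%:R)); first by rewrite powR_gt0 // invr_gt0.
have ln_large : \forall d \near \oo, 1 <= ln d%:R :> R.
  exists (Num.truncn (expR (1 : R))).+1 => // d /= dM.
  have d0 : 0 < d%:R :> R by rewrite ltr0n (leq_trans _ dM).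
  rewrite -ler_expR lnK ?posrE //.
  by apply/ltW/(lt_le_trans (truncnS_gt _)); rewrite ler_nat.
near=> d; have ln1 : 1 <= ln d%:R :> R by near: d.
have lnL : (L * ln d%:R) ^+ p.+2 <= d%:R by near: d; apply: ln_power_le.
have sd : (3 * #|block_index p| <= d)%N.
  by near: d; apply: nbhs_infty_ge.
set y : R := ln d%:R in ln1 lnL.
have y0 : 0 < y by lra.
have Ly1 : 1 <= L * y by apply: mulr_ege1 => //; lra.
have Lyd : L * y <= d%:R.
  by apply: le_trans lnL; rewrite exprS ler_peMr ?exprn_ege1 //; lra.
have d1 : 1 <= d%:R :> R by apply: le_trans Lyd.
have Ky0 : 0 < K * y by apply: mulr_gt0.
have KyL : K * y <= L * y by rewrite ler_pM2r.
pose x : R := d%:R ^+ 3 / y.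
have xK1 : 1 <= x / K.
  rewrite /x -mulrA -invfM ler_pdivlMr; last by rewrite mulrC.
  rewrite mul1r mulrC; apply: le_trans KyL _; apply: le_trans Lyd _.
  by rewrite ler_eXnr.
have xK0 : 0 <= x / K by lra.
pose z := (x / K) `^ (1 / e%:R).
have ze : z ^+ e = x / K.
  by rewrite -powR_mulrn ?powR_ge0 // -powRrM divfK ?gt_eqF // powRr1.
have z0 : 0 <= z by apply: powR_ge0.
pose k := Num.truncn z; have /andP[kz zk] := truncn_itv z0; rewrite -/k in kz zk.
have z1 : 1 <= z by rewrite -(expr_ge1 e_gt0 z0) ze.
have k0 : (0 < k)%N by rewrite truncn_gt0.
have kx : K * k%:R ^+ e * y <= d%:R ^+ 3.
  have : k%:R ^+ e <= x / K by rewrite -ze lerXn2r ?nnegrE.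
  by rewrite ler_pdivlMr // ler_pdivlMr // [K * _]mulrC.
have xk : d%:R ^+ 3 <= L * y * k%:R ^+ e.
  have : x / K <= (2 * k%:R) ^+ e.
    rewrite -ze lerXn2r ?nnegrE ?mulr_ge0 // ltW // (lt_le_trans zk) //.
    by rewrite -natrM ler_nat mul2n -addnn -addn1 leq_add2l.
  by rewrite ler_pdivrMr // ler_pdivrMr // exprMn /L; lra.
(* Otherwise, raising [xk] to the power r - 1 would give
   d ^ (3r - 3) < d * d ^ (3r - 4), where [lnL] absorbs the logarithm. *)
have dk : (d <= k ^ p.+2)%N.
  rewrite leqNgt; apply/negP => kd.
  have : (d%:R ^+ 3) ^+ p.+2 <= d%:R * (k ^ p.+2)%:R ^+ e :> R.
    apply: (@le_trans _ _ ((L * y * k%:R ^+ e) ^+ p.+2)).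
      by rewrite lerXn2r ?nnegrE ?exprn_ge0 // ?mulr_ge0 ?exprn_ge0 //; lra.
    rewrite exprMn natrX exprAC ler_pM // exprn_ge0 //; lra.
  apply/negP; rewrite -ltNge -exprM (_ : 3 * p.+2 = e.+1)%N; last first.
    by rewrite /e; clear; lia.
  rewrite exprS ltr_pM2l; last by lra.
  by rewrite ltrXn2r // ?ltr_nat // -lt0n.
have [|n [H [Hr Hd forced]]] :=
    forcing_hypergraph_exists k0 dk sd ln1 _ kx.
  by apply: le_trans Lyd; rewrite ler_pM2r //; lra.
exists k, n, H; split=> //; rewrite eE -powRM ?invr_ge0 ?(ltW K0) //.
  by rewrite mulrC; apply: ltW.
by apply: divr_ge0; [apply: exprn_ge0|apply: ltW].
Unshelve. all: by end_near.
Qed.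

Theorem corollary5 (R : realType) (r : nat) (hr : (3 <= r)%N) :
  ((fun d : nat => (max_chi_s r d)%:R : R) \is 'Omega_\oo
     (fun d : nat => (d%:R ^+ 3 / ln d%:R) `^ (1 / (3 * r%:R - 4)) : R))
  /\
  ((fun d : nat => (max_chi_a r d)%:R : R) \is 'Omega_\oo
     (fun d : nat => (d%:R ^+ 3 / ln d%:R) `^ (1 / (3 * r%:R - 4)) : R)).
Proof.
case: r hr => [|[|[|p]]] // r3.
have [c c0 forcing] := forcing_hypergraph_eventually R p.
have omega (F : nat -> nat) :
    (forall d n k (H : hypergraph 'I_n), H \subset complete_hypergraph n p.+3 ->
      max_degree H = d -> forces_colors H k -> (k < F d)%N) ->
    (fun d : nat => (F d)%:R : R) \is 'Omega_\oo
      (fun d : nat => (d%:R ^+ 3 / ln d%:R) `^ (1 / (3 * p.+3%:R - 4)) : R).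
  move=> F_gt; apply/asboolP; exists c => //.
  near=> d.
  have [k [n [H [Hr Hd forced le_k]]]] :
    exists (k n : nat) (H : hypergraph 'I_n),
    [/\ H \subset complete_hypergraph n p.+3, max_degree H = d,
      forces_colors H k
    & c * (d%:R ^+ 3 / ln d%:R) `^ (1 / (3 * p.+3%:R - 4)) <= k.+1%:R].
    by near: d.
  rewrite !ger0_norm ?powR_ge0 //; apply: le_trans le_k _.
  by rewrite ler_nat; apply: F_gt forced.
split; apply: omega => d n k H.
- exact: max_chi_s_gt.
- exact: max_chi_a_gt.
Unshelve. all: by end_near.
Qed.
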